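(* The pentablock $\mathcal P\subset\mathbb C^3$ is linearly convex.
   Context: Let $\mathcal R_I=\{z\in\mathbb C^{2\times2}:\|z\|<1\}$, where $\|\cdot\|$ is the operator norm. The pentablock is the domain $\mathcal P=\pi(\mathcal R_I)\subset\mathbb C^3$, where $\pi(z)=(z_{12},\operatorname{tr}z,\det z)$ for $z=(z_{ij})$. A set $D\subset\mathbb C^n$ is linearly convex if for every $a\in\mathbb C^n\setminus D$ there is a complex (affine) hyperplane passing through $a$ and disjoint from $D$. *)

(* Defs.v *)
From HB Require Import structures.
From mathcomp Require Import all_boot all_order all_algebra.
From mathcomp Require Import complex.
From mathcomp Require Import boolp classical_sets reals.

Set Implicit Arguments.
Unset Strict Implicit.
Unset Printing Implicit Defensive.

Import Order.TTheory GRing.Theory Num.Theory.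

Local Open Scope classical_set_scope.
Local Open Scope ring_scope.
Local Open Scope complex_scope.

(* The norm `|z| of z : R[i] is itself an element of R[i]; the modulus with
   values in R is Normc.normc. *)
Definition euclidean_norm (R : realType) (n : nat) (v : 'cV[R[i]]_n) : R :=
  Num.sqrt (\sum_(i < n) Normc.normc (v i 0) ^+ 2).

Definition operator_norm (R : realType) (m n : nat) (A : 'M[R[i]]_(m, n)) : R :=
  sup [set euclidean_norm (A *m v) |
        v in [set v : 'cV[R[i]]_n | euclidean_norm v <= 1]].

(* Coordinates are indexed from 0: the entry z_12 is z 0 1. *)
Definition cartan_ball (R : realType) : set 'M[R[i]]_2 :=
  [set z | operator_norm z < 1].

Definition pentablock_map (R : realType) (z : 'M[R[i]]_2) : 'rV[R[i]]_3 :=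
  \row_(j < 3) [:: z 0 1; \tr z; \det z]`_j.

Definition pentablock (R : realType) : set 'rV[R[i]]_3 :=
  [set pentablock_map z | z in @cartan_ball R].
Arguments pentablock R : clear implicits.

Definition complex_hyperplane (R : realType) (n : nat)
    (H : set 'rV[R[i]]_n) : Prop :=
  exists (c : 'rV[R[i]]_n) (b : R[i]),
    c != 0 /\ H = [set x | \sum_(j < n) c 0 j * x 0 j = b].

Definition linearly_convex (R : realType) (n : nat)
    (D : set 'rV[R[i]]_n) : Prop :=
  forall a : 'rV[R[i]]_n, ~ D a ->
    exists H : set 'rV[R[i]]_n,
      [/\ complex_hyperplane H, H a & H `&` D = set0].

(* Main.v *)
(* A point (a, s, p) of the pentablock comes from a strict contraction A, which
   has no eigenvalue of modulus at least 1; and since the Moebius transform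
   (A - z^* I)(I - z A)^-1 is again a strict contraction when |z| < 1, its (1, 2)
   entry yields |a| (1 - |z|^2) < |1 - s z + p z^2|. Each of these conditions keeps
   a complex hyperplane off the domain: l^2 - s l + p = 0 with |l| >= 1, and
   1 - s z + p z^2 = w a with |w| <= 1 - |z|^2. Conversely, let l1, l2 be the roots
   of X^2 - s X + p, in the open disc, and put
   B = sqrt ((1 - |l1|^2) (1 - |l2|^2)) and N = |1 - l1 l2^*|. If |a| < (B + N) / 2,
   some matrix with these data has squared Frobenius norm less than
   1 + |det|^2, hence operator norm less than 1; otherwise the second condition fails
   at the hyperbolic midpoint z of l1^* and l2^*, where
   |1 - s z + p z^2| / (1 - |z|^2) = (B + N) / 2. *)
Require Import Defs.
From mathcomp Require Import all_boot all_order all_algebra.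
From mathcomp Require Import complex.
From mathcomp Require Import boolp classical_sets reals.
From mathcomp Require Import ring.

Set Implicit Arguments.
Unset Strict Implicit.
Unset Printing Implicit Defensive.

Import Order.TTheory GRing.Theory Num.Theory.

Local Open Scope ring_scope.

(** * Strict contractions of the plane: constraints on their entries, trace and determinant *)

Definition sqnorm (C : numClosedFieldType) (n : nat) (v : 'cV[C]_n) : C :=
  \sum_i `|v i 0| ^+ 2.

(** Vectorwise form of operator norm below 1, free of suprema and so meaningful over any
    [numClosedFieldType]. *)
Definition strict_contraction (C : numClosedFieldType) (A : 'M[C]_2) : Prop :=
  forall v : 'cV[C]_2, v != 0 -> sqnorm (A *m v) < sqnorm v.

Lemma det_mx22 (R : comNzRingType) (A : 'M[R]_2) :
  \det A = A 0 0 * A 1 1 - A 0 1 * A 1 0.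
Proof.
rewrite (expand_det_row _ 0) !big_ord_recl big_ord0 addr0 /cofactor !det_mx11.
rewrite !mxE /= expr0 mul1r expr1 mulN1r mulrN.
by congr (_ * A _ _ - A _ _ * A _ _); apply/val_inj.
Qed.

Lemma trace_mx22 (R : nmodType) (A : 'M[R]_2) : \tr A = A 0 0 + A 1 1.
Proof.
rewrite /mxtrace !big_ord_recl big_ord0 addr0.
by congr (_ + A _ _); apply/val_inj.
Qed.

Lemma sqnorm_mul22 (C : numClosedFieldType) (A : 'M[C]_2) (v : 'cV[C]_2) :
  sqnorm (A *m v) = `|A 0 0 * v 0 0 + A 0 1 * v 1 0| ^+ 2
                  + `|A 1 0 * v 0 0 + A 1 1 * v 1 0| ^+ 2.
Proof.
rewrite /sqnorm !big_ord_recl big_ord0 addr0 !mxE !big_ord_recl !big_ord0 !addr0.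
by congr (`|A _ _ * _ + A _ _ * v _ _| ^+ 2 + `|A _ _ * _ + A _ _ * v _ _| ^+ 2);
  apply/val_inj.
Qed.

Lemma sqnorm2 (C : numClosedFieldType) (v : 'cV[C]_2) :
  sqnorm v = `|v 0 0| ^+ 2 + `|v 1 0| ^+ 2.
Proof.
rewrite /sqnorm !big_ord_recl big_ord0 addr0.
by congr (_ + `|v _ _| ^+ 2); apply/val_inj.
Qed.

Lemma strict_contraction_entries (C : numClosedFieldType) (A : 'M[C]_2) (x y : C) :
  strict_contraction A -> (x != 0) || (y != 0) ->
  `|A 0 0 * x + A 0 1 * y| ^+ 2 + `|A 1 0 * x + A 1 1 * y| ^+ 2
    < `|x| ^+ 2 + `|y| ^+ 2.
Proof.
move=> cA xy; pose v := \col_(i < 2) [:: x; y]`_i.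
have /cA : v != 0.
  apply: contraTneq xy => v0; rewrite -negb_and negbK.
  by move: (congr1 (fun w : 'cV_2 => w 0 0) v0) (congr1 (fun w : 'cV_2 => w 1 0) v0);
    rewrite !mxE /= => -> ->; rewrite !eqxx.
by rewrite sqnorm_mul22 sqnorm2 !mxE.
Qed.

Lemma strict_contraction_entry00 (C : numClosedFieldType) (A : 'M[C]_2) :
  strict_contraction A -> `|A 0 0| < 1.
Proof.
move=> cA; rewrite -(expr_lt1 (n := 2)) //.
have := strict_contraction_entries (x := 1) (y := 0) cA.
rewrite oner_neq0 !mulr1 !mulr0 !addr0 normr1 normr0 expr1n expr0n addr0 => /(_ isT).
by apply: le_lt_trans; rewrite lerDl exprn_ge0.
Qed.

(** At a root [l], the vector (a12, l - a11) would be an eigenvector for [l], nonzero since |a11| <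
    1 <= |l|; it cannot shrink when |l| >= 1. *)
Lemma strict_contraction_char_poly_neq0 (C : numClosedFieldType) (A : 'M[C]_2) (l : C) :
  strict_contraction A -> 1 <= `|l| -> l ^+ 2 - \tr A * l + \det A != 0.
Proof.
move=> cA l1; apply/negP => /eqP root_l.
have nz : (A 0 1 != 0) || (l - A 0 0 != 0).
  rewrite orbC subr_eq0; case: eqP => //= la.
  by have := strict_contraction_entry00 cA; rewrite -la le_gtF.
have := strict_contraction_entries cA nz.
have -> : A 0 0 * A 0 1 + A 0 1 * (l - A 0 0) = l * A 0 1 by ring.
have -> : A 1 0 * A 0 1 + A 1 1 * (l - A 0 0) = l * (l - A 0 0).
  by apply/eqP; rewrite eq_sym -subr_eq0 -root_l trace_mx22 det_mx22; apply/eqP; ring.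
rewrite !normrM !exprMn -mulrDr le_gtF // ler_peMl ?addr_ge0 ?exprn_ge0 //.
by rewrite exprn_ege1.
Qed.

Lemma strict_contraction_offdiag_lt (C : numClosedFieldType) (A : 'M[C]_2) (z : C) :
  strict_contraction A -> `|z| < 1 ->
  `|A 0 1| * (1 - `|z| ^+ 2) < `|1 - \tr A * z + \det A * z ^+ 2|.
Proof.
move=> cA z1.
have z2 : 0 < 1 - `|z| ^+ 2 by rewrite subr_gt0 expr_lt1.
(* The vector (z a12, 1 - z a11) is mapped to (0, det (1 - z A)) by 1 - z A. *)
have nz : (z * A 0 1 != 0) || (1 - z * A 0 0 != 0).
  rewrite orbC subr_eq0; case: eqP => //= /(congr1 Num.norm).
  rewrite normr1 normrM => zA; have := strict_contraction_entry00 cA.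
  by move/(mulr_ilt1 (normr_ge0 _) (normr_ge0 _) z1); rewrite -zA ltxx.
have := strict_contraction_entries cA nz.
have -> : A 0 0 * (z * A 0 1) + A 0 1 * (1 - z * A 0 0) = A 0 1 by ring.
have -> : A 1 0 * (z * A 0 1) + A 1 1 * (1 - z * A 0 0) = A 1 1 - z * \det A.
  by rewrite det_mx22; ring.
rewrite -subr_gt0 => /(mulr_gt0 z2) pos.
rewrite -(ltr_pXn2r (n := 2)) ?nnegrE ?mulr_ge0 ?(ltW z2) // -subr_gt0.
apply: lt_le_trans pos _.
rewrite exprMn.
(* With w = 1 - z a11 and u = a22 - z det A, the determinant of 1 - z A is w - z u, and |w - z u|^2
   = (1 - |z|^2) (|w|^2 - |u|^2) + |u - conj z w|^2. *)
have -> : `|1 - \tr A * z + \det A * z ^+ 2| ^+ 2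
         - `|A 0 1| ^+ 2 * (1 - `|z| ^+ 2) ^+ 2
       = (1 - `|z| ^+ 2) * (`|z * A 0 1| ^+ 2 + `|1 - z * A 0 0| ^+ 2
           - (`|A 0 1| ^+ 2 + `|A 1 1 - z * \det A| ^+ 2))
         + `|A 1 1 - z * \det A - z^* * (1 - z * A 0 0)| ^+ 2.
  by rewrite !normCK trace_mx22 det_mx22 !(rmorphB, rmorphM) /= conjCK; ring.
by rewrite lerDl exprn_ge0.
Qed.

(** * A Frobenius norm criterion for contractions *)

(** A Hermitian form with nonnegative diagonal and determinant: multiplied by its trace [al + be] it
    becomes a sum of nonnegative terms, and if the trace is 0 all coefficients vanish. *)
Lemma hermitian2_ge0 (C : numClosedFieldType) (al be g x y : C) :
  0 <= al -> 0 <= be -> `|g| ^+ 2 <= al * be ->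
  0 <= al * `|x| ^+ 2 + be * `|y| ^+ 2 - (g * x * y^* + (g * x * y^*)^*).
Proof.
move=> al0 be0 gab.
have [ab0|ab0] := eqVneq (al + be) 0.
  move/eqP: ab0; rewrite paddr_eq0 // => /andP[/eqP al_0 /eqP be_0].
  have -> : g = 0.
    apply/eqP; rewrite -normr_eq0 -[_ == 0](expf_eq0 _ 2) eq_le exprn_ge0 // andbT.
    by rewrite (le_trans gab) // al_0 mul0r.
  by rewrite al_0 be_0 !mul0r conjC0 !addr0 subr0.
have abpos : 0 < al + be by rewrite lt_def ab0 addr_ge0.
rewrite -(pmulr_rge0 _ abpos).
have -> : (al + be) * (al * `|x| ^+ 2 + be * `|y| ^+ 2
                       - (g * x * y^* + (g * x * y^*)^*))
  = `|al * x - g^* * y| ^+ 2 + `|be * y - g * x| ^+ 2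
    + (al * be - `|g| ^+ 2) * (`|x| ^+ 2 + `|y| ^+ 2).
  have [ac bc] : al^* = al /\ be^* = be.
    by split; apply: conj_Creal; rewrite ger0_real.
  rewrite !normCK !(rmorphB, rmorphM) /= !conjCK ac bc; ring.
by apply: addr_ge0; [|apply: mulr_ge0]; rewrite ?subr_ge0 // addr_ge0 ?exprn_ge0.
Qed.

Lemma real_nonneg_of_sum_prod (R : numDomainType) (x y : R) :
  x \is Num.real -> 0 <= x + y -> 0 <= x * y -> 0 <= x.
Proof.
move=> xR xy0 xy; case: real_leP => // x0.
have y0 : y <= 0 by rewrite -(nmulr_rge0 y x0).
by have := lt_le_trans (ltr_wnDr y0 x0) xy0; rewrite ltxx.
Qed.

(* The witness bounds the largest eigenvalue of A^* A, whose characteristic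
   polynomial X^2 - F X + |det A|^2 is nonnegative at it. *)
Lemma frobenius_contraction (C : numClosedFieldType) (A : 'M[C]_2) :
  `|A 0 0| ^+ 2 + `|A 0 1| ^+ 2 + `|A 1 0| ^+ 2 + `|A 1 1| ^+ 2
    < 1 + `|\det A| ^+ 2 ->
  `|\det A| < 1 ->
  exists2 q : C, 0 <= q < 1 & forall v, sqnorm (A *m v) <= q * sqnorm v.
Proof.
set F := (X in X < _) => FA detA.
have e1 : `|\det A| ^+ 2 <= 1 by rewrite exprn_ile1 // ltW.
pose c := 1 + `|\det A| ^+ 2 - F; have c0 : 0 < c by rewrite subr_gt0.
pose q := 1 - c / 2.
have F0 : 0 <= F by rewrite !addr_ge0 ?exprn_ge0.
have qF : F <= 2 * q.
  rewrite -subr_ge0 (_ : _ - _ = 1 - `|\det A| ^+ 2) ?subr_ge0 //.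
  by rewrite /q /c; field.
have q0 : 0 <= q by rewrite -(pmulr_rge0 q (ltr0Sn C 1)) (le_trans F0 qF).
exists q.
  by rewrite q0 /= /q ltrBlDr ltrDl divr_gt0.
move=> v; rewrite sqnorm_mul22 sqnorm2 -subr_ge0.
(* [al] and [be] are the diagonal entries of q I - A^* A, and [g] is the (2, 1) entry of A^* A. *)
pose al := q - (`|A 0 0| ^+ 2 + `|A 1 0| ^+ 2).
pose be := q - (`|A 0 1| ^+ 2 + `|A 1 1| ^+ 2).
pose g := A 0 0 * (A 0 1)^* + A 1 0 * (A 1 1)^*.
have sum0 : 0 <= al + be.
  by rewrite (_ : _ + _ = 2 * q - F) ?subr_ge0 // /al /be /F; ring.
have prod0 : `|g| ^+ 2 <= al * be.
  rewrite -subr_ge0 (_ : _ - _ = c ^+ 2 / 4 + c / 2 * F).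
    have c0' := ltW c0; apply: addr_ge0; first by rewrite divr_ge0 ?exprn_ge0.
    by rewrite mulr_ge0 ?divr_ge0.
  by rewrite /g /al /be /q /c /F det_mx22 !normCK !(rmorphM, rmorphD) /= !conjCK; field.
have [alR beR] : al \is Num.real /\ be \is Num.real.
  by split; apply: rpredB; rewrite ger0_real // addr_ge0 ?exprn_ge0.
have al0 : 0 <= al.
  by apply: real_nonneg_of_sum_prod sum0 (le_trans _ prod0); rewrite ?exprn_ge0.
have be0 : 0 <= be.
  by apply: (@real_nonneg_of_sum_prod _ _ al) => //;
    rewrite ?(addrC be) ?(mulrC be) // (le_trans _ prod0) ?exprn_ge0.
have := hermitian2_ge0 (v 0 0) (v 1 0) al0 be0 prod0.
congr (0 <= _); rewrite /al /be /g !normCK !(rmorphM, rmorphD) /= !conjCK; ring.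
Qed.

(** * Prescribed off-diagonal entry, trace and determinant: completion or obstruction *)

Lemma normC_parallelogram (C : numClosedFieldType) (x y : C) :
  `|x + y| ^+ 2 + `|x - y| ^+ 2 = 2 * (`|x| ^+ 2 + `|y| ^+ 2).
Proof. by rewrite !normCK; ring. Qed.

(* The matrices s I + [[y, a], [c, - y]] with y ^ 2 + a c = d ^ 2 have eigenvalues
   s + d and s - d; the first alternative makes them normal. *)
Lemma traceless_completion (C : numClosedFieldType) (a d : C) :
  exists y c : C, y ^+ 2 + a * c = d ^+ 2 /\
    (2 * `|y| ^+ 2 + `|a| ^+ 2 + `|c| ^+ 2 = 2 * `|d| ^+ 2 \/
     [/\ `|d| < `|a|, y = 0 & c = d ^+ 2 / a]).
Proof.
have [ad|da] := real_leP (normr_real a) (normr_real d); last first.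
  have a0 : a != 0 by rewrite -normr_gt0 (le_lt_trans _ da).
  exists 0, (d ^+ 2 / a); split; last by right.
  by rewrite expr0n add0r mulrC divfK.
have [d0|d0] := eqVneq d 0.
  have a0 : a = 0 by apply/eqP; rewrite -normr_le0 -(normr0 C) -d0.
  exists 0, 0; rewrite a0 d0; split; first by ring.
  by left; rewrite !normr0; ring.
pose r := 1 - `|a| ^+ 2 / `|d| ^+ 2.
have nd0 : 0 < `|d| ^+ 2 by rewrite exprn_gt0 // normr_gt0.
have r0 : 0 <= r.
  by rewrite subr_ge0 ler_pdivrMr // mul1r lerXn2r ?nnegrE.
(* Here |c| = |a|, and [r] is chosen so that |y|^2 = |d|^2 - |a|^2. *)
exists (d * sqrtC r), (d ^+ 2 * a^* / `|d| ^+ 2).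
have dn : `|d| != 0 by rewrite normr_eq0.
split.
  by rewrite exprMn sqrtCK /r; move: (normCK a) => ->; field.
left; rewrite !normrM !exprMn normfV !normrX norm_conjC normr_id.
rewrite (ger0_norm (x := sqrtC r)) ?sqrtC_ge0 // sqrtCK /r.
by field.
Qed.

Lemma normC_defect_mul_gt0 (C : numClosedFieldType) (l1 l2 : C) :
  `|l1| < 1 -> `|l2| < 1 -> 0 < (1 - `|l1| ^+ 2) * (1 - `|l2| ^+ 2).
Proof. by move=> h1 h2; rewrite mulr_gt0 // subr_gt0 expr_lt1. Qed.

(** Shift the traceless completion by half the trace. In the normal case the margin in the Frobenius
    criterion is B^2 > 0, with B the square root in the statement; otherwise it is B^2 - t^2 with t
    = |a| - |d|^2 / |a|, so only B <= t obstructs. *)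
Lemma matrix_offdiag_completion (C : numClosedFieldType) (a l1 l2 : C) :
  `|l1| < 1 -> `|l2| < 1 ->
  (exists A : 'M[C]_2, [/\ A 0 1 = a, \tr A = l1 + l2, \det A = l1 * l2 &
     `|A 0 0| ^+ 2 + `|A 0 1| ^+ 2 + `|A 1 0| ^+ 2 + `|A 1 1| ^+ 2
       < 1 + `|\det A| ^+ 2]) \/
  `|(l1 - l2) / 2| < `|a| /\
  sqrtC ((1 - `|l1| ^+ 2) * (1 - `|l2| ^+ 2))
    <= `|a| - `|(l1 - l2) / 2| ^+ 2 / `|a|.
Proof.
move=> h1 h2; set d := (l1 - l2) / 2; set B2 := _ * (1 - _).
have B0 : 0 < B2 by exact: normC_defect_mul_gt0.
pose s := (l1 + l2) / 2.
have sd : 2 * `|s| ^+ 2 + 2 * `|d| ^+ 2 = `|l1| ^+ 2 + `|l2| ^+ 2.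
  rewrite -mulrDr -normC_parallelogram.
  have -> : s + d = l1 by rewrite /s /d; field.
  by have -> : s - d = l2 by rewrite /s /d; field.
have [y [c [yc hyc]]] := traceless_completion a d.
pose A := \matrix_(i < 2, j < 2)
   (if i == 0 then (if j == 0 then s + y else a)
    else (if j == 0 then c else s - y)).
have A01 : A 0 1 = a by rewrite mxE.
have trA : \tr A = l1 + l2 by rewrite trace_mx22 !mxE /= /s; field.
have detA : \det A = l1 * l2.
  rewrite det_mx22 !mxE /= (_ : _ - _ = s ^+ 2 - (y ^+ 2 + a * c)); last by ring.
  by rewrite yc /s /d; field.
have FA : `|A 0 0| ^+ 2 + `|A 0 1| ^+ 2 + `|A 1 0| ^+ 2 + `|A 1 1| ^+ 2
   = 2 * `|s| ^+ 2 + (2 * `|y| ^+ 2 + `|a| ^+ 2 + `|c| ^+ 2).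
  rewrite !mxE /=.
  rewrite (_ : _ + _ = `|s + y| ^+ 2 + `|s - y| ^+ 2 + (`|a| ^+ 2 + `|c| ^+ 2)).
    by rewrite normC_parallelogram; ring.
  by ring.
have BE : 1 + `|l1 * l2| ^+ 2 - (`|l1| ^+ 2 + `|l2| ^+ 2) = B2.
  by rewrite /B2 normrM; ring.
case: hyc => [hF|[da y0 cE]].
  left; exists A; split=> //.
  by rewrite FA hF sd detA -subr_gt0 BE.
have a0 : 0 < `|a| by apply: le_lt_trans da.
have cN : `|c| = `|d| ^+ 2 / `|a| by rewrite cE normrM normrX normfV.
set t := `|a| - _.
have t0 : 0 <= t.
  by rewrite subr_ge0 ler_pdivrMr // -expr2 lerXn2r ?nnegrE // ltW.
have tE : 1 + `|l1 * l2| ^+ 2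
    - (2 * `|s| ^+ 2 + (2 * `|y| ^+ 2 + `|a| ^+ 2 + `|c| ^+ 2)) = B2 - t ^+ 2.
  by rewrite -BE -sd y0 cN normr0 /t; field; rewrite gt_eqF.
have sB0 : 0 <= sqrtC B2 by rewrite sqrtC_ge0 ltW.
have [Bt|tB] := real_leP (ger0_real sB0) (ger0_real t0); first by right.
left; exists A; split=> //.
rewrite FA detA -subr_gt0 tE subr_gt0 -(sqrtCK B2).
by rewrite ltrXn2r ?nnegrE.
Qed.

(* z is the hyperbolic midpoint of the conjugates of l1 and l2, where the product
   of the two factors |1 - l_i z| / sqrt (1 - |z| ^ 2) is minimal. *)
Lemma hyperbolic_midpoint (C : numClosedFieldType) (l1 l2 : C) :
  `|l1| < 1 -> `|l2| < 1 ->
  exists2 z : C, `|z| < 1 &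
    `|1 - (l1 + l2) * z + l1 * l2 * z ^+ 2|
      = (sqrtC ((1 - `|l1| ^+ 2) * (1 - `|l2| ^+ 2)) + `|1 - l1 * l2^*|) / 2
        * (1 - `|z| ^+ 2).
Proof.
move=> h1 h2; set B := sqrtC _; set N := `|1 - _|.
have B0 : 0 < B by rewrite sqrtC_gt0 normC_defect_mul_gt0.
pose n := 1 - l1 * l2^*.
have l12 : `|l1 * l2| < 1 by rewrite normrM mulr_ilt1.
have N0 : 0 < N.
  rewrite normr_gt0 subr_eq0; apply: contraTneq l12 => /(congr1 Num.norm).
  by rewrite normr1 !normrM norm_conjC => <-; rewrite ltxx.
pose T := 1 - `|l1 * l2| ^+ 2.
have T0 : 0 < T by rewrite subr_gt0 expr_lt1.
have BN0 : 0 < B * N by rewrite mulr_gt0.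
have W0 : 0 < T + B * N by rewrite addr_gt0.
have [b1R b2R] : (1 - `|l1| ^+ 2)^* = 1 - `|l1| ^+ 2 /\
                 (1 - `|l2| ^+ 2)^* = 1 - `|l2| ^+ 2.
  by split; apply: conj_Creal; rewrite rpredB ?ger0_real ?exprn_ge0.
have BNR : (B * N)^* = B * N by apply: conj_Creal; rewrite ger0_real ?ltW.
have B2 : B ^+ 2 = (1 - `|l1| ^+ 2) * (1 - `|l2| ^+ 2) by rewrite sqrtCK.
have N2 : N ^+ 2 = n * n^* by rewrite normCK.
have nC : n^* = 1 - l1^* * l2 by rewrite /n rmorphB rmorphM /= conjCK rmorph1.
(* The midpoint of u = conj l1 and v = conj l2 solves (u + v) (1 + |z|^2) = 2 (z + u v conj z), so
   it is a nonnegative multiple of [X] with |X| |z|^2 - 2 T |z| + |X| = 0; [X2] evaluates the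
   discriminant. *)
pose X := (l1 + l2)^* - (l1 + l2) * (l1 * l2)^*.
have X2 : `|X| ^+ 2 = T ^+ 2 - (B * N) ^+ 2.
  rewrite exprMn B2 N2 nC /n /T /X !normCK !(rmorphB, rmorphD, rmorphM) /=.
  by rewrite !conjCK; ring.
pose z := X / (T + B * N).
have W_neq0 : T + B * N != 0 by rewrite gt_eqF.
have z2 : 1 - `|z| ^+ 2 = 2 * (B * N) / (T + B * N).
  by rewrite normrM normfV exprMn X2 (gtr0_norm W0); field.
exists z.
  by rewrite -(expr_lt1 (n := 2)) // -subr_gt0 z2 divr_gt0 ?mulr_gt0.
have lz1 : 1 - l1 * z = ((1 - `|l1| ^+ 2) * n + B * N) / (T + B * N).
  apply: (mulIf W_neq0); rewrite divfK // mulrBl mul1r -[l1 * _ * _]mulrA divfK //.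
  rewrite /X /T /n !normCK.
  by rewrite !(rmorphD, rmorphM) /=; ring.
have lz2 : 1 - l2 * z = ((1 - `|l2| ^+ 2) * n^* + B * N) / (T + B * N).
  apply: (mulIf W_neq0); rewrite divfK // mulrBl mul1r -[l2 * _ * _]mulrA divfK //.
  rewrite /X /T nC !normCK.
  by rewrite !(rmorphD, rmorphM) /=; ring.
(* Equidistance: through [K], both |1 - l_i z|^2 / (1 - |l_i|^2) equal N (B + N) / (T + B N). *)
have K : N * (2 - `|l1| ^+ 2 - `|l2| ^+ 2) + B * (n + n^*)
       = (T + B * N) * (B + N).
  have -> : 2 - `|l1| ^+ 2 - `|l2| ^+ 2 = T + B ^+ 2.
    by rewrite B2 /T normrM; ring.
  have -> : n + n^* = T + N ^+ 2.
    by rewrite N2 nC /n /T !normCK rmorphM /=; ring.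
  by ring.
have P1 : `|(1 - `|l1| ^+ 2) * n + B * N| ^+ 2
        = (1 - `|l1| ^+ 2) * N * ((T + B * N) * (B + N)).
  rewrite -K [LHS]normCK rmorphD /= BNR rmorphM /= b1R.
  rewrite [LHS](_ : _ = (1 - `|l1| ^+ 2) ^+ 2 * (n * n^*) + B ^+ 2 * N ^+ 2
    + (1 - `|l1| ^+ 2) * (B * N) * (n + n^*)); last by ring.
  by rewrite -N2 B2; ring.
have P2 : `|(1 - `|l2| ^+ 2) * n^* + B * N| ^+ 2
        = (1 - `|l2| ^+ 2) * N * ((T + B * N) * (B + N)).
  rewrite -K [LHS]normCK [(_ + B * N)^*]rmorphD /= BNR [(_ * n^*)^*]rmorphM /= b2R conjCK.
  rewrite [LHS](_ : _ = (1 - `|l2| ^+ 2) ^+ 2 * (n * n^*) + B ^+ 2 * N ^+ 2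
    + (1 - `|l2| ^+ 2) * (B * N) * (n + n^*)); last by ring.
  by rewrite -N2 B2; ring.
apply: (@pexpIrn _ 2); rewrite ?nnegrE //.
  rewrite z2; apply: mulr_ge0; first by rewrite divr_ge0 ?addr_ge0 ?(ltW B0) ?(ltW N0).
  by rewrite divr_ge0 ?(ltW W0) // mulr_ge0 // ltW.
rewrite (_ : 1 - _ + _ = (1 - l1 * z) * (1 - l2 * z)); last by ring.
rewrite lz1 lz2 z2 !normrM !exprMn P1 P2 normfV (gtr0_norm W0).
rewrite (_ : B ^+ 2 = B * B) // in B2 *.
have := B2; move: (1 - `|l1| ^+ 2) (1 - `|l2| ^+ 2) => b1 b2 B2'.
rewrite (_ : b1 * N * _ * _ * _ = B * B * N ^+ 2 * ((B + N) ^+ 2 / (T + B * N) ^+ 2)).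
  by field.
by rewrite B2'; field.
Qed.

(** Since |1 - l1 conj l2|^2 = B^2 + 4 |d|^2, the threshold is the larger root of X^2 - B X - |d|^2,
    while the hypothesis says this polynomial is nonnegative at |a|. *)
Lemma offdiag_threshold (C : numClosedFieldType) (a l1 l2 : C) :
  let B := sqrtC ((1 - `|l1| ^+ 2) * (1 - `|l2| ^+ 2)) in
  0 <= B -> `|(l1 - l2) / 2| < `|a| ->
  B <= `|a| - `|(l1 - l2) / 2| ^+ 2 / `|a| ->
  (B + `|1 - l1 * l2^*|) / 2 <= `|a|.
Proof.
move=> B B0; set d := (l1 - l2) / 2 => da Ba.
have a0 : 0 < `|a| by apply: le_lt_trans da.
have Ba' : 0 <= 2 * `|a| - B.
  rewrite subr_ge0 (le_trans Ba) // lerBlDr (le_trans (y := 2 * `|a|)) //.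
    by rewrite ler_peMl ?ler1n.
  by rewrite lerDl divr_ge0 ?exprn_ge0.
rewrite ler_pdivrMr // [_ * 2]mulrC -lerBrDl.
rewrite -(@ler_pXn2r _ 2) ?nnegrE //.
rewrite -subr_ge0.
have -> : (2 * `|a| - B) ^+ 2 - `|1 - l1 * l2^*| ^+ 2
   = 4 * (`|a| * (`|a| - `|d| ^+ 2 / `|a| - B)).
  rewrite (_ : `|1 - l1 * l2^*| ^+ 2 = B ^+ 2 + 4 * `|d| ^+ 2); last first.
    rewrite sqrtCK /d normrM exprMn normfV normr_nat !normCK.
    by rewrite !(rmorphB, rmorphM) /= conjCK; field.
  by field; rewrite gt_eqF.
by rewrite !mulr_ge0 ?subr_ge0 // ltW.
Qed.

Lemma vieta2 (C : numClosedFieldType) (s p : C) :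
  exists l1 l2 : C, s = l1 + l2 /\ p = l1 * l2.
Proof.
pose r := sqrtC (s ^+ 2 - 4 * p).
have r2 : r ^+ 2 = s ^+ 2 - 4 * p by rewrite sqrtCK.
exists ((s - r) / 2), ((s + r) / 2); split; first by field.
rewrite (_ : (s - r) / 2 * ((s + r) / 2) = (s ^+ 2 - r ^+ 2) / 4); last by field.
by rewrite r2; field.
Qed.

(** The first case gives membership, the other two a hyperplane; they may overlap. A uniform [q] is
    kept because strict inequalities alone could have supremum 1. *)
Lemma pentablock_trichotomy (C : numClosedFieldType) (a s p : C) :
  [\/ exists A : 'M[C]_2, [/\ A 0 1 = a, \tr A = s, \det A = p &
        exists2 q : C, 0 <= q < 1 & forall v, sqnorm (A *m v) <= q * sqnorm v],
      exists2 l : C, 1 <= `|l| & l ^+ 2 - s * l + p = 0 |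
      exists2 z : C, `|z| < 1 & a != 0 /\
        `|1 - s * z + p * z ^+ 2| <= `|a| * (1 - `|z| ^+ 2)].
Proof.
have [l1 [l2 [-> ->]]] := vieta2 s p.
have [le1|h1] := real_leP (real1 C) (normr_real l1).
  by apply: Or32; exists l1 => //; ring.
have [le2|h2] := real_leP (real1 C) (normr_real l2).
  by apply: Or32; exists l2 => //; ring.
case: (matrix_offdiag_completion a h1 h2) => [[A [A01 trA detA FA]]|[da Ba]].
  apply: Or31; exists A; split=> //.
  by apply: frobenius_contraction => //; rewrite detA normrM mulr_ilt1.
have [z z1 zE] := hyperbolic_midpoint h1 h2.
apply: Or33; exists z => //; split.
  by rewrite -normr_gt0 (le_lt_trans _ da).
rewrite zE ler_wpM2r ?subr_ge0 ?exprn_ile1 ?(ltW z1) //.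
by apply: offdiag_threshold => //; rewrite sqrtC_ge0 ltW ?normC_defect_mul_gt0.
Qed.

(** * Passage to the operator norm *)

(** A crude bound suffices: it serves to show that the set under the supremum in [operator_norm] is
    bounded. *)
Lemma sqnorm_mul22_le (C : numClosedFieldType) (A : 'M[C]_2) (v : 'cV[C]_2) :
  sqnorm (A *m v) <= 2 * (`|A 0 0| ^+ 2 + `|A 0 1| ^+ 2
                          + `|A 1 0| ^+ 2 + `|A 1 1| ^+ 2) * sqnorm v.
Proof.
have par (x y : C) : `|x + y| ^+ 2 <= 2 * (`|x| ^+ 2 + `|y| ^+ 2).
  by rewrite -normC_parallelogram lerDl exprn_ge0.
rewrite sqnorm_mul22 sqnorm2; apply: le_trans (lerD (par _ _) (par _ _)) _.
rewrite -subr_ge0 !normrM; set x := `|v 0 0|; set y := `|v 1 0|.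
rewrite (_ : _ - _ = 2 * ((`|A 0 0| ^+ 2 + `|A 1 0| ^+ 2) * y ^+ 2
                        + (`|A 0 1| ^+ 2 + `|A 1 1| ^+ 2) * x ^+ 2)); last by ring.
by rewrite mulr_ge0 // addr_ge0 // mulr_ge0 ?addr_ge0 ?exprn_ge0 // normr_ge0.
Qed.

Local Open Scope classical_set_scope.
Local Open Scope complex_scope.

Lemma euclidean_norm_ge0 (R : realType) (n : nat) (v : 'cV[R[i]]_n) :
  0 <= euclidean_norm v.
Proof. exact: sqrtr_ge0. Qed.

Lemma euclidean_norm_sqr (R : realType) (n : nat) (v : 'cV[R[i]]_n) :
  (euclidean_norm v ^+ 2)%:C = sqnorm v.
Proof.
rewrite sqr_sqrtr ?sumr_ge0 // => [|i _]; last by rewrite sqr_ge0.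
by rewrite rmorph_sum; apply: eq_bigr => i _; rewrite rmorphXn.
Qed.

Lemma sqnormZ (C : numClosedFieldType) (n : nat) (c : C) (v : 'cV[C]_n) :
  sqnorm (c *: v) = `|c| ^+ 2 * sqnorm v.
Proof.
by rewrite /sqnorm mulr_sumr; apply: eq_bigr => i _; rewrite mxE normrM exprMn.
Qed.

Lemma euclidean_normZ (R : realType) (n : nat) (c : R) (v : 'cV[R[i]]_n) :
  0 <= c -> euclidean_norm (c%:C *: v) = c * euclidean_norm v.
Proof.
move=> c0; apply: (@pexpIrn _ 2); rewrite ?nnegrE ?mulr_ge0 ?euclidean_norm_ge0 //.
apply: complexI; rewrite euclidean_norm_sqr sqnormZ exprMn rmorphM.
by rewrite -euclidean_norm_sqr ger0_norm ?ler0c // -rmorphXn.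
Qed.

Lemma sqnorm_gt0 (C : numClosedFieldType) (n : nat) (v : 'cV[C]_n) :
  v != 0 -> 0 < sqnorm v.
Proof.
move=> v0; rewrite lt_def sumr_ge0 ?andbT; last by move=> i _; rewrite exprn_ge0.
apply: contra v0 => /eqP/psumr_eq0P v0; apply/eqP/matrixP => i j.
rewrite ord1 mxE; apply/eqP; rewrite -normr_eq0 -[_ == 0](expf_eq0 _ 2).
by apply/eqP/v0 => // k _; rewrite exprn_ge0.
Qed.

Lemma euclidean_norm_mul_le (R : realType) (A : 'M[R[i]]_2) (q : R[i]) :
  0 <= q -> (forall v, sqnorm (A *m v) <= q * sqnorm v) ->
  exists2 k : R, q = k%:C &
    forall w, euclidean_norm w <= 1 -> euclidean_norm (A *m w) <= Num.sqrt k.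
Proof.
move=> q0 Aq.
have [k qE] : exists k : R, q = k%:C by apply/complex_realP; rewrite ger0_real.
have k0 : 0 <= k by rewrite -ler0c -qE.
exists k => // w w1.
rewrite -(ler_sqr (euclidean_norm_ge0 _) (sqrtr_ge0 _)) (sqr_sqrtr k0) -lecR -qE.
rewrite euclidean_norm_sqr (le_trans (Aq _)) // ler_piMr // -euclidean_norm_sqr.
by rewrite lecR expr_le1 // euclidean_norm_ge0.
Qed.

Lemma cartan_ball_strict_contraction (R : realType) (A : 'M[R[i]]_2) :
  cartan_ball A -> strict_contraction A.
Proof.
rewrite /cartan_ball /= => A1 v v0.
set S := [set euclidean_norm (A *m v) | v in [set v | euclidean_norm v <= 1]] in A1.
have ubS : has_ubound S.
  have [|k _ Ak] := euclidean_norm_mul_le _ (sqnorm_mul22_le A).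
    by rewrite mulr_ge0 // !addr_ge0 ?exprn_ge0.
  by exists (Num.sqrt k) => _ [w /= w1 <-]; exact: Ak.
have sv := sqnorm_gt0 v0; set r := euclidean_norm v.
have r0 : 0 < r.
  rewrite lt_def euclidean_norm_ge0 andbT; apply: contraTneq sv => rv.
  by rewrite -euclidean_norm_sqr -/r rv expr0n ltxx.
have ri0 : 0 <= r^-1 by rewrite invr_ge0 ltW.
(* Rescaling [v] to a unit vector places its stretching ratio in [S]. *)
have Su : S (r^-1 * euclidean_norm (A *m v)).
  exists ((r^-1)%:C *: v); first by rewrite /= euclidean_normZ // mulVf ?gt_eqF.
  by rewrite -scalemxAr euclidean_normZ.
have := le_lt_trans (ub_le_sup ubS Su) A1.
rewrite mulrC ltr_pdivrMr // mul1r -!euclidean_norm_sqr ltcR.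
by rewrite ltr_sqr ?nnegrE ?euclidean_norm_ge0 ?(ltW r0).
Qed.

Lemma cartan_ball_of_sqnorm_le (R : realType) (A : 'M[R[i]]_2) (q : R[i]) :
  0 <= q < 1 -> (forall v, sqnorm (A *m v) <= q * sqnorm v) -> cartan_ball A.
Proof.
move=> /andP[q0 q1] Aq; rewrite /cartan_ball /=.
have [k qE Ak] := euclidean_norm_mul_le q0 Aq.
apply: (@le_lt_trans _ _ (Num.sqrt k)); last first.
  by rewrite -sqrtr1 ltr_sqrt // -ltcR -qE.
apply: ge_sup.
  (* [ge_sup] asks for a nonempty set; the zero vector supplies a point. *)
  by exists (euclidean_norm (A *m 0)), 0 => //=; rewrite -(expr_le1 (n := 2))
    ?euclidean_norm_ge0 // -lecR euclidean_norm_sqr /sqnorm big1 // => i _;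
    rewrite mxE normr0 expr0n.
by move=> _ [w /= w1 <-]; exact: Ak.
Qed.

(** * Hyperplanes avoiding the pentablock *)

Lemma row3P (T : Type) (x y : 'rV[T]_3) :
  x 0 0 = y 0 0 -> x 0 1 = y 0 1 -> x 0 2 = y 0 2 -> x = y.
Proof.
move=> h0 h1 h2; apply/rowP => -[[|[|[|//]]] hj].
- by rewrite (_ : Ordinal _ = 0) //; apply/val_inj.
- by rewrite (_ : Ordinal _ = 1) //; apply/val_inj.
- by rewrite (_ : Ordinal _ = 2) //; apply/val_inj.
Qed.

Lemma complex_hyperplane3 (R : realType) (c0 c1 c2 b : R[i]) :
  [|| c0 != 0, c1 != 0 | c2 != 0] ->
  complex_hyperplane
    [set x : 'rV[R[i]]_3 | c0 * x 0 0 + c1 * x 0 1 + c2 * x 0 2 = b].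
Proof.
move=> c_neq0; pose c := \row_(j < 3) [:: c0; c1; c2]`_j.
exists c, b; split.
  apply: contraTneq c_neq0 => c_eq0.
  have cE j : c 0 j = 0 by rewrite c_eq0 mxE.
  by move: (cE 0) (cE 1) (cE 2); rewrite !mxE /= => -> -> ->; rewrite eqxx.
apply/seteqP; split=> x /= <-; rewrite !big_ord_recl big_ord0 addr0 addrA !mxE /=.
  by congr (_ + _ * x _ _ + _ * x _ _); apply/val_inj.
by congr (_ + _ * x _ _ + _ * x _ _); apply/val_inj.
Qed.

Lemma pentablock_strict_contraction (R : realType) (x : 'rV[R[i]]_3) :
  pentablock R x -> exists A : 'M[R[i]]_2,
    [/\ strict_contraction A, x 0 0 = A 0 1, x 0 1 = \tr A & x 0 2 = \det A].
Proof.
case=> A /cartan_ball_strict_contraction cA <-.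
by exists A; split=> //; rewrite mxE.
Qed.

Theorem proposition9 (R : realType) : linearly_convex (pentablock R).
Proof.
move=> x xP.
case: (pentablock_trichotomy (x 0 0) (x 0 1) (x 0 2)) =>
    [[A [A01 trA detA [q q01 Aq]]]|[l l1 root_l]|[z z1 [x0 zle]]].
- case: xP; exists A; first exact: cartan_ball_of_sqnorm_le q01 Aq.
  by apply: row3P; rewrite mxE.
(* The points (a, s, p) for which [l] is a root of X^2 - s X + p. *)
- exists [set y | 0 * y 0 0 + - l * y 0 1 + 1 * y 0 2 = - l ^+ 2]; split.
  + by apply: complex_hyperplane3; rewrite oner_neq0 !orbT.
  + by apply: (addIr (l ^+ 2)); rewrite /= addNr -[RHS]root_l; ring.
  apply/seteqP; split=> // y [/= yH /pentablock_strict_contraction[A [cA _ y1 y2]]].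
  have /eqP := strict_contraction_char_poly_neq0 cA l1; case.
  rewrite -y1 -y2; apply: (addIr (- l ^+ 2)); rewrite add0r -[RHS]yH; ring.
(* Chosen so that the plane 1 - s z + p z^2 = w a passes through [x]; then [zle] says |w| <= 1 -
   |z|^2. *)
pose w := (1 - x 0 1 * z + x 0 2 * z ^+ 2) / x 0 0.
have wx : w * x 0 0 + z * x 0 1 + - z ^+ 2 * x 0 2 = 1.
  by rewrite /w divfK //; ring.
exists [set y | w * y 0 0 + z * y 0 1 + - z ^+ 2 * y 0 2 = 1]; split=> //.
  apply: complex_hyperplane3; apply/negP => /negP; rewrite !negb_or !negbK.
  move=> /and3P[/eqP w0 /eqP z0 /eqP z20]; move/eqP: wx.
  by rewrite w0 z20 z0 !mul0r !addr0 eq_sym oner_eq0.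
apply/seteqP; split=> // y [/= yH /pentablock_strict_contraction[A [cA y0 y1 y2]]].
have := strict_contraction_offdiag_lt cA z1; rewrite -y0 -y1 -y2.
have -> : 1 - y 0 1 * z + y 0 2 * z ^+ 2 = y 0 0 * w.
  by rewrite -{1}yH; ring.
rewrite normrM le_gtF // ler_wpM2l // normrM normfV ler_pdivrMr ?normr_gt0 //.
by rewrite [leRHS]mulrC.
Qed.
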